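(* For every integer $n\geq3$ and every integer $k\geq2$, \begin{align*} C(n,n-2)&=C(n,n-1)=C(n,n),\\ D(n,n-2)&=D(n,n-1)=D(n,n),\\ \mu(n,n-2)&=\mu(n,n-1)=\mu(n,n),\\ T(n,n-2,k)&=T(n,n-1,k)=T(n,n,k). \end{align*} For every integer $n\geq5$, \[ C(n,n-3)<C(n,n-2),\qquad D(n,n-3)<D(n,n-2). \]
   Context: For integers $1\leq v\leq n$, let \[ \mathcal{M}_{n,v}=\left\{\frac{n!}{e_1!\cdots e_v!}: e_1+\cdots+e_v=n,\ e_i\geq0\text{ integers}\right\} \] as a set (repeated values removed). For a finite set $A$ of positive integers and an integer $t$, put $r_A(t)=\#\{(x,y):x,y\in A,\ x\leq y,\ x+y=t\}$, and define $C(A)=\sum_t\max(r_A(t)-1,0)$, $D(A)=\#\{t:r_A(t)\geq2\}$, $\mu(A)=\max_t r_A(t)$, $T(A,k)=\#\{t:r_A(t)\geq k\}$. Write $C(n,v)=C(\mathcal{M}_{n,v})$, $D(n,v)=D(\mathcal{M}_{n,v})$, $\mu(n,v)=\mu(\mathcal{M}_{n,v})$, $T(n,v,k)=T(\mathcal{M}_{n,v},k)$. *)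

(* Defs.v *)
From mathcomp Require Import all_boot finmap.

Set Implicit Arguments.
Unset Strict Implicit.
Unset Printing Implicit Defensive.

Local Open Scope fset_scope.
Local Open Scope nat_scope.

(* The natural-number division is exact when the [e i] sum to [n]
   (see [multinomialsP]). *)
Definition multinomial (n v : nat) (e : {ffun 'I_v -> 'I_n.+1}) : nat :=
  n`! %/ \prod_(i < v) (e i)`!.

(* Parts summing to [n] are at most [n], so ranging over ['I_n.+1] loses
   nothing. *)
Definition multinomials (n v : nat) : {fset nat} :=
  [fset multinomial e
    | e in [pred e : {ffun 'I_v -> 'I_n.+1} | \sum_(i < v) e i == n]].

Definition rep (A : {fset nat}) (t : nat) : nat :=
  #|` [fset p in A `*` A | (p.1 <= p.2) && (p.1 + p.2 == t)] |.

(* [rep A] vanishes outside [sumset A] (see [rep_notin]), so the sum, maximum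
   and counts over all [t] below are taken over this finite set; for
   [card_rep_ge A k] this requires [0 < k]. *)
Definition sumset (A : {fset nat}) : {fset nat} :=
  [fset x + y | x in A, y in A].

(* Truncated subtraction: [r - 1] is max(r - 1, 0). *)
Definition coll (A : {fset nat}) : nat := \sum_(t <- sumset A) (rep A t - 1).

Definition card_rep_ge (A : {fset nat}) (k : nat) : nat :=
  #|` [fset t in sumset A | k <= rep A t] |.

Definition card_coll (A : {fset nat}) : nat :=
  #|` [fset t in sumset A | 2 <= rep A t] |.

Definition max_rep (A : {fset nat}) : nat := \max_(t <- sumset A) rep A t.

Definition Cnv (n v : nat) : nat := coll (multinomials n v).
Definition Dnv (n v : nat) : nat := card_coll (multinomials n v).
Definition munv (n v : nat) : nat := max_rep (multinomials n v).
Definition Tnv (n v k : nat) : nat := card_rep_ge (multinomials n v) k.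

Lemma rep_notin (A : {fset nat}) (t : nat) : t \notin sumset A -> rep A t = 0.
Proof.
move=> tA; apply/eqP; rewrite cardfs_eq0; apply/eqP/fsetP=> -[x y].
rewrite !inE /=; apply/negP => /andP[/andP[xA yA]] /andP[_ /eqP xyt].
by move/negP: tA; apply; rewrite -xyt; apply/imfset2P; exists x => //; exists y.
Qed.

Lemma prod_fact_dvd (v : nat) (e : 'I_v -> nat) :
  \prod_(i < v) (e i)`! %| (\sum_(i < v) e i)`!.
Proof.
elim: v e => [|v IHv] e; first by rewrite !big_ord0.
rewrite !big_ord_recl; set s := \sum_(i < v) _.
have le_es : e ord0 <= e ord0 + s by rewrite leq_addr.
rewrite -(bin_fact le_es) addKn dvdn_mull // dvdn_mul //; exact: IHv.
Qed.

Lemma multinomialsP (n v x : nat) :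
  reflect (exists2 e : 'I_v -> nat,
             \sum_(i < v) e i = n & x * \prod_(i < v) (e i)`! = n`!)
          (x \in multinomials n v).
Proof.
apply: (iffP (imfsetP _ _ _ _)) => /= [[e /eqP sum_e ->]|[e sum_e xE]].
  exists (fun i => e i : nat) => //; rewrite divnK // -[in _`!]sum_e.
  exact: prod_fact_dvd.
have e_le i : e i < n.+1 by rewrite ltnS -sum_e (bigD1 i) //= leq_addr.
exists [ffun i => Ordinal (e_le i)].
  by apply/eqP; rewrite -[RHS]sum_e; apply: eq_bigr => i _; rewrite ffunE.
rewrite /multinomial; under eq_bigr do rewrite ffunE /=.
by rewrite -xE mulnK // prodn_gt0 // => i; exact: fact_gt0.
Qed.

(* Main.v *)
Require Import Defs.
From mathcomp Require Import all_boot finmap zify.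

(** Allowing one more part adds to the set a single new value as long as at most
    two parts are missing: [n!/2] for [n - 1] parts and [n!] for [n] parts.  Each
    is at least twice every earlier value, so its sums exceed all earlier sums
    and are pairwise distinct: no repetition is created.  From [n - 3] to
    [n - 2] parts, the identity [n!/12 + n!/4 = n!/6 + n!/6] creates a repeated
    sum [n!/3], whereas two values with [n - 3] parts, being at most [n!/8],
    never add up to [n!/3]. *)

Set Implicit Arguments.
Unset Strict Implicit.
Unset Printing Implicit Defensive.

Local Open Scope fset_scope.
Local Open Scope nat_scope.

(** * Sumsets and representation counts *)

Lemma mem_sumset (A : {fset nat}) (t : nat) :
  reflect (exists x y, [/\ x \in A, y \in A & x + y = t]) (t \in sumset A).
Proof.
apply: (iffP (imfset2P _ _ _ _ _)) => /= [[x xA [y yA ->]]|[x [y [xA yA <-]]]].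
  by exists x, y.
by exists x => //; exists y.
Qed.

Lemma sumsetS (A B : {fset nat}) : A `<=` B -> sumset A `<=` sumset B.
Proof.
move=> /fsubsetP AB; apply/fsubsetP => t /mem_sumset[x [y [xA yA <-]]].
by apply/mem_sumset; exists x, y; split=> //; exact: AB.
Qed.

Lemma repS (A B : {fset nat}) (t : nat) : A `<=` B -> rep A t <= rep B t.
Proof.
move=> /fsubsetP AB; apply/fsubset_leq_card/fsubsetP => -[x y].
by rewrite !inE /= => /andP[/andP[/AB -> /AB ->]].
Qed.

Lemma rep_gt0 (A : {fset nat}) (t : nat) : t \in sumset A -> 0 < rep A t.
Proof.
case/mem_sumset=> x [y [xA yA <-]]; rewrite cardfs_gt0.
apply/fset0Pn; case: (leqP x y) => xy; [exists (x, y)|exists (y, x)].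
  by rewrite !inE /= xA yA xy eqxx.
by rewrite !inE /= xA yA (ltnW xy) addnC eqxx.
Qed.

Lemma rep_ge2 (A : {fset nat}) (a b c d : nat) :
  [/\ a \in A, b \in A, c \in A & d \in A] ->
  a <= b -> c <= d -> a != c -> a + b = c + d -> 2 <= rep A (a + b).
Proof.
move=> [aA bA cA dA] ab cd ac abcd.
have <- : #|` [fset (a, b); (c, d)]| = 2.
  by rewrite cardfs2 xpair_eqE (negPf ac).
apply/fsubset_leq_card/fsubsetP => p; rewrite !inE => /orP[]/eqP-> /=.
  by rewrite aA bA ab eqxx.
by rewrite cA dA cd abcd eqxx.
Qed.

(** * Adjoining an element at least twice every earlier one *)

Section AddLarge.
Variables (A : {fset nat}) (m : nat).
Hypothesis A_gt0 : forall a, a \in A -> 0 < a.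
Hypothesis A_half : forall a, a \in A -> a + a <= m.

Lemma sumset_range t : t \in sumset A -> 0 < t <= m.
Proof.
case/mem_sumset=> x [y [xA yA <-]].
by have := A_gt0 xA; have := A_half xA; have := A_half yA; lia.
Qed.

(** A pair containing [m] has sum above [m], since its other entry is positive, whereas sums from
    [A] are at most [m]. *)
Lemma rep_fset1U_in t : t \in sumset A -> rep (m |` A) t = rep A t.
Proof.
move=> /sumset_range /andP[t_gt0 tm]; congr #|` _|; apply/fsetP => -[x y].
rewrite !inE /=; apply/idP/idP => [|/andP[/andP[-> ->] ->]]; last by rewrite !orbT.
case/andP=> /andP[/orP[/eqP->|xA] /orP[/eqP->|yA]] /andP[xy /eqP xyt].
- by exfalso; lia.
- by exfalso; have := A_gt0 yA; lia.
- by exfalso; have := A_gt0 xA; lia.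
- by rewrite xA yA xy xyt eqxx.
Qed.

(** Such a [t] needs a pair containing [m]. As [m] is the largest element, it comes second, and only
    the pair [(t - m, m)] remains. *)
Lemma rep_fset1U_notin t : t \notin sumset A -> rep (m |` A) t <= 1.
Proof.
move=> tA; rewrite -(cardfs1 (t - m, m)); apply/fsubset_leq_card/fsubsetP.
move=> -[x y]; rewrite !inE xpair_eqE /=.
case/andP=> /andP[/orP[/eqP->|xA] /orP[/eqP->|yA]] /andP[xy /eqP xyt]; try lia.
- by have := A_gt0 yA; have := A_half yA; lia.
- by case/mem_sumset: tA; exists x, y.
Qed.

Let subA : sumset A `<=` sumset (m |` A).
Proof. exact/sumsetS/fsubsetU1. Qed.

Lemma coll_fset1U : coll (m |` A) = coll A.
Proof.
(* Sums outside [sumset A] have count at most 1, so the truncated difference contributes 0. *)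
rewrite /coll -(big_fset_incl _ subA) => [|t _ /rep_fset1U_notin]; last by lia.
by apply: eq_big_seq => t /rep_fset1U_in ->.
Qed.

Lemma card_rep_ge_fset1U k : 2 <= k -> card_rep_ge (m |` A) k = card_rep_ge A k.
Proof.
move=> k2; congr #|` _|; apply/fsetP => t; rewrite !inE /=.
have [tA|tA] := boolP (t \in sumset A).
  by rewrite (fsubsetP subA) //= rep_fset1U_in.
by have := rep_fset1U_notin tA; case: (t \in sumset (m |` A)) => //=; lia.
Qed.

(** New sums have count at most 1. Nonemptiness of [A] makes the old maximum at least 1, witnessed
    by some [a + a]. *)
Lemma max_rep_fset1U : A != fset0 -> max_rep (m |` A) = max_rep A.
Proof.
case/fset0Pn=> a aA; apply/eqP; rewrite eqn_leq; apply/andP; split.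
  apply/bigmax_leqP_seq => t _ _.
  have [tA|/rep_fset1U_notin le1] := boolP (t \in sumset A).
    by rewrite rep_fset1U_in //; apply: leq_bigmax_seq.
  have aaA : a + a \in sumset A by apply/mem_sumset; exists a, a.
  apply: leq_trans le1 (leq_trans (rep_gt0 aaA) _).
  exact: leq_bigmax_seq.
apply/bigmax_leqP_seq => t tA _; rewrite -rep_fset1U_in //.
by apply: leq_bigmax_seq => //; exact: (fsubsetP subA).
Qed.

End AddLarge.

(** * Strict growth caused by a newly repeated sum *)

Section NewRepetition.
Variables (A B : {fset nat}) (t : nat).
Hypotheses (AB : A `<=` B) (tA : t \notin sumset A) (tB : 2 <= rep B t).

Let t_sumset : t \in sumset B.
Proof. by apply: contraLR tB => /rep_notin ->. Qed.

(** The term at [t] rises from 0 to at least 1, and no other term decreases. *)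
Lemma coll_lt : coll A < coll B.
Proof.
(* Both sums now range over [sumset B]; the terms added for [A] vanish. *)
rewrite /coll (big_fset_incl _ (sumsetS AB)) => [|s _ /rep_notin -> //].
rewrite !(big_fsetD1 t t_sumset) /= (rep_notin tA) -addSn leq_add //; first by lia.
by apply: leq_sum => s _; rewrite leq_sub2r // repS.
Qed.

Lemma card_coll_lt : card_coll A < card_coll B.
Proof.
apply/fproper_ltn_card; rewrite fproperE; apply/andP; split.
  apply/fsubsetP => s; rewrite !inE /= => /andP[sA le2].
  rewrite (fsubsetP (sumsetS AB)) //=; exact: leq_trans le2 (repS _ AB).
by apply/fsubsetPn; exists t; rewrite !inE /= ?t_sumset // (negPf tA).
Qed.

End NewRepetition.

(** * Multinomial values: size, explicit members, effect of one more part *)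

Lemma multinomials_gt0 (n v x : nat) : x \in multinomials n v -> 0 < x.
Proof.
case/multinomialsP=> e _ xE; have := fact_gt0 n.
by rewrite -xE muln_gt0 => /andP[].
Qed.

(* From [2 ^ e <= 2 * e`!], valid also for empty parts. *)
Lemma multinomials_le (n v x : nat) :
  x \in multinomials n v -> x * 2 ^ n <= n`! * 2 ^ v.
Proof.
case/multinomialsP=> e <- <-; rewrite -mulnA leq_mul2l; apply/orP; right.
have -> : 2 ^ v = \prod_(i < v) 2 by rewrite prod_nat_const card_ord.
rewrite expn_sum -big_split /=; apply: leq_prod => i _.
elim: (e i) => // -[|k] //= IH; rewrite expnS factS; move: IH.
by set f := k.+1`!; set p := 2 ^ k.+1; nia.
Qed.

Lemma mem_multinomials (v : nat) (e : 'I_v -> nat) :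
  (\sum_(i < v) e i)`! %/ \prod_(i < v) (e i)`!
    \in multinomials (\sum_(i < v) e i) v.
Proof.
by apply/multinomialsP; exists e; rewrite ?divnK ?prod_fact_dvd.
Qed.

Lemma multinomialsS (n v : nat) : multinomials n v `<=` multinomials n v.+1.
Proof.
apply/fsubsetP => x /multinomialsP[e se pe]; apply/multinomialsP.
(* The additional part is empty and contributes a factor 1. *)
exists (fun i => if unlift ord0 i is Some j then e j else 0).
  by rewrite big_ord_recl unlift_none; under eq_bigr do rewrite liftK.
rewrite big_ord_recl unlift_none; under eq_bigr do rewrite liftK.
by rewrite mul1n.
Qed.

(** Take one part [n - v] and [v] parts equal to 1. *)
Lemma multinomials_head (n v : nat) :
  v <= n -> n`! %/ (n - v)`! \in multinomials n v.+1.
Proof.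
move=> le_vn; pose e (i : 'I_v.+1) :=
  if unlift ord0 i is Some _ then 1 else n - v.
have se : \sum_i e i = n.
  rewrite big_ord_recl /e unlift_none; under eq_bigr do rewrite liftK.
  by rewrite sum1_card card_ord subnK.
have pe : \prod_i (e i)`! = (n - v)`!.
  rewrite big_ord_recl /e unlift_none; under eq_bigr do rewrite liftK.
  by rewrite big1_eq muln1.
by have := mem_multinomials e; rewrite se pe.
Qed.

(** Take the parts [n - v - p] and [p] together with [v] ones. *)
Lemma multinomials_head2 (n v p : nat) :
  p + v <= n -> n`! %/ ((n - v - p)`! * p`!) \in multinomials n v.+2.
Proof.
move=> le_pvn; pose e (i : 'I_v.+2) :=
  if unlift ord0 i is Some j then (if unlift ord0 j is Some _ then 1 else p)
  else n - v - p.
have se : \sum_i e i = n.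
  rewrite !big_ord_recl /e unlift_none liftK unlift_none.
  by under eq_bigr do rewrite !liftK; rewrite sum1_card card_ord; lia.
have pe : \prod_i (e i)`! = (n - v - p)`! * p`!.
  rewrite !big_ord_recl /e unlift_none liftK unlift_none.
  by under eq_bigr do rewrite !liftK; rewrite big1_eq muln1.
by have := mem_multinomials e; rewrite se pe.
Qed.

Lemma multinomials_recr (n v : nat) :
  v <= n ->
  (forall e : 'I_v.+1 -> nat, (forall i, 0 < e i) -> \sum_i e i = n ->
     \prod_i (e i)`! = (n - v)`!) ->
  multinomials n v.+1 = n`! %/ (n - v)`! |` multinomials n v.
Proof.
move=> le_vn pos_prod; apply/fsetP => x; rewrite !inE.
apply/idP/orP => [|[/eqP->|]]; last 2 first.
- exact: multinomials_head.
- exact: (fsubsetP (multinomialsS n v)).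
case/multinomialsP=> e se pe.
have [/forallP e_gt0|] := boolP [forall i, 0 < e i].
  by left; rewrite -pe pos_prod // mulnK ?fact_gt0.
rewrite negb_forall => /existsP[j]; rewrite -eqn0Ngt => /eqP ej; right.
move: se pe; rewrite (bigD1_ord j) //= ej add0n => se.
rewrite (bigD1_ord j) //= ej mul1n => pe.
by apply/multinomialsP; exists (e \o lift j).
Qed.

Lemma positive_sum_ge (v : nat) (e : 'I_v -> nat) :
  (forall i, 0 < e i) -> v <= \sum_i e i.
Proof.
by move=> e_gt0; rewrite -[leqLHS]card_ord -sum1_card; exact: leq_sum.
Qed.

(** Every part must equal 1. *)
Lemma prod_fact_sum_eq (v : nat) (e : 'I_v -> nat) :
  (forall i, 0 < e i) -> \sum_i e i = v -> \prod_i (e i)`! = 1.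
Proof.
elim: v e => [|v IH] e e_gt0; first by rewrite !big_ord0.
rewrite !big_ord_recl; set s := \sum_(i < v) _ => se.
have ge_v : v <= s by exact: positive_sum_ge.
have e0 := e_gt0 ord0.
have [-> sE] : e ord0 = 1 /\ s = v by lia.
by rewrite IH.
Qed.

Lemma prod_fact_sum_succ (v : nat) (e : 'I_v -> nat) :
  (forall i, 0 < e i) -> \sum_i e i = v.+1 -> \prod_i (e i)`! = 2.
Proof.
elim: v e => [|v IH] e e_gt0; first by rewrite big_ord0.
rewrite !big_ord_recl; set s := \sum_(i < v) _ => se.
have ge_v : v <= s by exact: positive_sum_ge.
have e0 := e_gt0 ord0.
(* The single unit of excess lies either in the later parts or in the first one. *)
have [[-> sE]|[-> sE]] : e ord0 = 1 /\ s = v.+1 \/ e ord0 = 2 /\ s = v by lia.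
  by rewrite IH.
by rewrite prod_fact_sum_eq.
Qed.

Lemma multinomials_diag (v : nat) :
  multinomials v.+1 v.+1 = v.+1`! |` multinomials v.+1 v.
Proof.
rewrite multinomials_recr ?subSnn ?divn1 // => e e_gt0.
exact: prod_fact_sum_eq.
Qed.

Lemma multinomials_subdiag (v : nat) :
  multinomials v.+2 v.+1 = v.+2`! %/ 2 |` multinomials v.+2 v.
Proof.
have subE : v.+2 - v = 2 by lia.
rewrite multinomials_recr ?subE //; first by lia.
by move=> e e_gt0; exact: prod_fact_sum_succ.
Qed.

Lemma multinomials_neq0 (n v : nat) : multinomials n v.+1 != fset0.
Proof.
apply/fset0Pn; elim: v => [|v [x xM]]; last first.
  by exists x; exact: (fsubsetP (multinomialsS _ _)).
by eexists; exact: (multinomials_head (leq0n n)).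
Qed.

Lemma multinomials_diag_double (v a : nat) :
  a \in multinomials v.+1 v -> a + a <= v.+1`!.
Proof.
move/multinomials_le; rewrite expnS mulnCA mulnA leq_pmul2r ?expn_gt0 //.
by lia.
Qed.

(** With two parts missing, [multinomials_le] bounds four times the value by the factorial. *)
Lemma multinomials_subdiag_double (v a : nat) :
  a \in multinomials v.+2 v -> a + a <= v.+2`! %/ 2.
Proof.
move/multinomials_le; rewrite !expnS !(mulnCA a) !mulnA leq_pmul2r ?expn_gt0 //.
by rewrite leq_divRL //; lia.
Qed.

(** * The repeated sum gained by the third-last part *)

Lemma new_repetition (n : nat) :
  exists2 t, t \notin sumset (multinomials n.+4.+1 n.+2)
           & 2 <= rep (multinomials n.+4.+1 n.+3) t.
Proof.
(* Apart from ones, the parts are 3 and 2 for [h12], 2 and 2 for [h4], and 3 alone for [h6], with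
   denominators 12, 4 and 6. *)
have h12 := multinomials_head2 (n := n.+4.+1) (v := n) (p := 2) ltac:(lia).
have h4 := multinomials_head2 (n := n.+4.+1) (v := n.+1) (p := 2) ltac:(lia).
have h6 := multinomials_head (n := n.+4.+1) (v := n.+2) ltac:(lia).
have E3 : n.+4.+1 - n - 2 = 3 by lia.
have E2 : n.+4.+1 - n.+1 - 2 = 2 by lia.
have E3' : n.+4.+1 - n.+2 = 3 by lia.
rewrite E3 in h12; rewrite E2 in h4; rewrite E3' in h6.
have dvd12 : 12 %| n.+4.+1`!.
  apply: (@dvdn_trans 5`!) => //; rewrite -(bin_fact (_ : 5 <= n.+4.+1)) //.
  exact/dvdn_mull/dvdn_mulr.
have [q nq] : exists q, n.+4.+1`! = q * 12 by exact/dvdnP.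
have q_gt0 : 0 < q by have := fact_gt0 n.+4.+1; lia.
move: h12 h4 h6; rewrite nq (_ : 3`! * 2`! = 12) // (_ : 2`! * 2`! = 4) //.
rewrite (_ : 3`! = 6) // mulnK // (_ : q * 12 %/ 4 = q * 3); last by lia.
rewrite (_ : q * 12 %/ 6 = q * 2); last by lia.
(* The value [q] comes with one part fewer than the other two, so it is carried along the
   inclusion. *)
move=> /(fsubsetP (multinomialsS _ _)) h12 h4 h6.
exists (q + q * 3).
  apply/mem_sumset => -[x [y [/multinomials_le + /multinomials_le]]].
  (* Eight times each value is at most [q * 12], so [x + y] is at most [q * 3], short of
     [q + q * 3]. *)
  have -> : 2 ^ n.+4.+1 = 8 * 2 ^ n.+2 by rewrite -(expnD 2 3).
  have : 0 < 2 ^ n.+2 by rewrite expn_gt0.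
  rewrite nq; move: (2 ^ n.+2) => P P_gt0.
  by rewrite !mulnA !leq_pmul2r //; lia.
by apply: (rep_ge2 (c := q * 2) (d := q * 2)); [split|lia..].
Qed.

Theorem proposition12p3 :
  (forall n k : nat, 3 <= n -> 2 <= k ->
     [/\ Cnv n (n - 2) = Cnv n (n - 1) /\ Cnv n (n - 1) = Cnv n n,
         Dnv n (n - 2) = Dnv n (n - 1) /\ Dnv n (n - 1) = Dnv n n,
         munv n (n - 2) = munv n (n - 1) /\ munv n (n - 1) = munv n n
       & Tnv n (n - 2) k = Tnv n (n - 1) k /\ Tnv n (n - 1) k = Tnv n n k])
  /\
  (forall n : nat, 5 <= n ->
     Cnv n (n - 3) < Cnv n (n - 2) /\ Dnv n (n - 3) < Dnv n (n - 2)).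
Proof.
split=> [[|[|[|n]]] k // _ k2|[|[|[|[|[|n]]]]] // _].
  have [-> ->] : n.+3 - 2 = n.+1 /\ n.+3 - 1 = n.+2 by lia.
  pose A := multinomials n.+3 n.+1; pose B := multinomials n.+3 n.+2.
  (* The bound [3 <= n] guarantees at least one part, hence a nonempty set. *)
  have A0 : A != fset0 by exact: multinomials_neq0.
  have B0 : B != fset0 by exact: multinomials_neq0.
  have BE : B = n.+3`! %/ 2 |` A by exact: multinomials_subdiag.
  have CE : multinomials n.+3 n.+3 = n.+3`! |` B by exact: multinomials_diag.
  have A_gt0 a : a \in A -> 0 < a by exact: multinomials_gt0.
  have B_gt0 a : a \in B -> 0 < a by exact: multinomials_gt0.
  have A_half a : a \in A -> a + a <= n.+3`! %/ 2.
    exact: multinomials_subdiag_double.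
  have B_half a : a \in B -> a + a <= n.+3`! by exact: multinomials_diag_double.
  rewrite /Cnv /Dnv /munv /Tnv CE -/A -/B.
  have collB := coll_fset1U B_gt0 B_half.
  have geB j := card_rep_ge_fset1U B_gt0 B_half (k := j).
  have maxB := max_rep_fset1U B_gt0 B_half B0.
  have collA := coll_fset1U A_gt0 A_half.
  have geA j := card_rep_ge_fset1U A_gt0 A_half (k := j).
  have maxA := max_rep_fset1U A_gt0 A_half A0.
  (* By definition [card_coll] is [card_rep_ge] at threshold 2, so the same lemma settles [Dnv] and
     [Tnv]. *)
  rewrite collB maxB (geB k) // -![card_coll _]/(card_rep_ge _ 2) geB //.
  by rewrite BE collA maxA !geA.
have [-> ->] : n.+4.+1 - 3 = n.+2 /\ n.+4.+1 - 2 = n.+3 by lia.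
have [t tA tB] := new_repetition n.
have AB := multinomialsS n.+4.+1 n.+2.
by split; [exact: coll_lt tA tB|exact: card_coll_lt tA tB].
Qed.
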